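(* Let $\mathfrak h$ be a Lie algebra with an LCS structure $(\omega,\theta)$, let $(V,\omega_0)$ be a symplectic vector space of dimension $2n$ with $n\ge 1$, and let $\pi:\mathfrak h\to\operatorname{End}(V)$ be a representation. Let $\mathfrak g=\mathfrak h\ltimes_\pi V$ and define $\tilde\omega\in\bigwedge^2\mathfrak g^*$ and $\tilde\theta\in\mathfrak g^*$ by $\tilde\omega|_{\mathfrak h}=\omega$, $\tilde\omega|_V=\omega_0$, $\tilde\omega(X,Y)=0$ for $X\in\mathfrak h$, $Y\in V$, and $\tilde\theta|_{\mathfrak h}=\theta$, $\tilde\theta|_V=0$. Then $(\tilde\omega,\tilde\theta)$ is an LCS structure on $\mathfrak g$ if and only if $\pi$ is an LCS representation, i.e. if and only if for every $X\in\mathfrak h$ one has $$\pi(X)=-\tfrac12\theta(X)\operatorname{Id}+\rho(X)\quad\text{with}\quad \rho(X)\in\mathfrak{sp}(V,\omega_0).$$ Moreover, in this case, $\rho:\mathfrak h\to\mathfrak{sp}(V,\omega_0)$ is a representation and $(\tilde\omega,\tilde\theta)$ is an LCS structure of the second kind.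
   Context: Lie algebras and vector spaces are real and finite-dimensional. An LCS (locally conformal symplectic) structure on a Lie algebra $\mathfrak g$ is a pair $(\omega,\theta)$ with $\omega\in\bigwedge^2\mathfrak g^*$ non-degenerate, $\theta\in\mathfrak g^*$ closed (i.e. vanishing on $[\mathfrak g,\mathfrak g]$), and $d\omega=\theta\wedge\omega$, where $d\omega(X,Y,Z)=-\omega([X,Y],Z)-\omega([Y,Z],X)-\omega([Z,X],Y)$ and $(\theta\wedge\omega)(X,Y,Z)=\theta(X)\omega(Y,Z)+\theta(Y)\omega(Z,X)+\theta(Z)\omega(X,Y)$. Put $\mathfrak g_\omega=\{X\in\mathfrak g:\omega([X,Y],Z)+\omega(Y,[X,Z])=0\ \text{for all } Y,Z\in\mathfrak g\}$. The LCS structure is of the first kind if $\theta|_{\mathfrak g_\omega}:\mathfrak g_\omega\to\mathbb R$ is surjective, and of the second kind if $\theta|_{\mathfrak g_\omega}$ is identically zero. A symplectic vector space $(V,\omega_0)$ is a vector space with a non-degenerate skew-symmetric bilinear form, and $\mathfrak{sp}(V,\omega_0)=\{A\in\operatorname{End}(V):\omega_0(AY,Z)=-\omega_0(Y,AZ)\ \text{for all } Y,Z\in V\}$. The semidirect product $\mathfrak h\ltimes_\pi V$ is the vector space $\mathfrak h\oplus V$ with the bracket of $\mathfrak h$ on $\mathfrak h$, $V$ an abelian ideal, and $[X,Y]=\pi(X)Y$ for $X\in\mathfrak h$, $Y\in V$. *)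

(* Defs.v *)
From HB Require Import structures.
From mathcomp Require Import all_boot all_order all_algebra.

Set Implicit Arguments.
Unset Strict Implicit.
Unset Printing Implicit Defensive.

Import GRing.Theory.
Local Open Scope ring_scope.

HB.mixin Record Vector_isLieAlgebra (R : fieldType) g of Vector R g := {
  lie : g -> g -> g;
  lie_linearl : forall Y, linear (lie^~ Y);
  lie_linearr : forall X, linear (lie X);
  liexx : forall X, lie X X = 0;
  lie_jacobi : forall X Y Z,
    lie X (lie Y Z) + lie Y (lie Z X) + lie Z (lie X Y) = 0
}.

#[short(type="lieAlgType")]
HB.structure Definition LieAlgebra (R : fieldType) :=
  { g of Vector R g & Vector_isLieAlgebra R g }.

Notation "[ 'lie' X , Y ]" := (lie X Y) (format "[ 'lie'  X ,  Y ]") : ring_scope.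

Section Representations.
Variables (R : fieldType) (h : lieAlgType R) (V : vectType R).

Definition is_representation (f : h -> 'End(V)) : Prop :=
  linear f /\ forall X Y, f [lie X, Y] = (f X \o f Y)%VF - (f Y \o f X)%VF.

Record representation := Representation {
  rep_fun :> h -> 'End(V);
  repP : is_representation rep_fun
}.

End Representations.

(* An alias of h * V, so that it can carry a bracket depending on pi. *)
Definition semidirect (R : fieldType) (h : lieAlgType R) (V : vectType R)
  (pi : representation h V) : Type := (h * V)%type.

Section SemidirectProduct.
Variables (R : fieldType) (h : lieAlgType R) (V : vectType R).
Variable pi : representation h V.
Local Notation g := (semidirect pi).

HB.instance Definition _ := Vector.copy g (h * V)%type.

Definition semidirect_lie (u v : g) : g :=
  ([lie u.1, v.1], pi u.1 v.2 - pi v.1 u.2).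

Fact semidirect_lie_linearl w : linear (semidirect_lie^~ w).
Proof.
have [pl _] := repP pi => a u v.
rewrite /semidirect_lie; congr pair => /=; first exact: lie_linearl.
by rewrite pl add_lfunE scale_lfunE linearP scalerBr opprD /= addrACA.
Qed.

Fact semidirect_lie_linearr w : linear (semidirect_lie w).
Proof.
have [pl _] := repP pi => a u v.
rewrite /semidirect_lie; congr pair => /=; first exact: lie_linearr.
by rewrite pl add_lfunE scale_lfunE linearP scalerBr opprD /= addrACA.
Qed.

Fact semidirect_liexx u : semidirect_lie u u = 0.
Proof. by rewrite /semidirect_lie liexx subrr. Qed.

Fact semidirect_jacobi u v w :
  semidirect_lie u (semidirect_lie v w) +
  semidirect_lie v (semidirect_lie w u) +
  semidirect_lie w (semidirect_lie u v) = 0.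
Proof.
have [_ pb] := repP pi.
rewrite /semidirect_lie /=; congr pair; first exact: lie_jacobi.
have brE X Y z : pi [lie X, Y] z = pi X (pi Y z) - pi Y (pi X z).
  by rewrite pb add_lfunE opp_lfunE !comp_lfunE.
rewrite /= !brE !(linearB (pi _)) /= !opprB.
set a := pi u.1 (pi v.1 w.2); set b := pi v.1 (pi u.1 w.2).
set c := pi u.1 (pi w.1 v.2); set d := pi w.1 (pi u.1 v.2).
set e := pi v.1 (pi w.1 u.2); set f := pi w.1 (pi v.1 u.2).
rewrite !addrA !addrNK (addrAC _ (- b) c) (addrAC _ f c) addrNK.
by rewrite (addrAC _ (- b) (- f)) addrK addrNK subrr.
Qed.

HB.instance Definition _ := Vector_isLieAlgebra.Build R g
  semidirect_lie_linearl semidirect_lie_linearr semidirect_liexx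
  semidirect_jacobi.

Definition semidirect_form (omega : {skew_symmetric h})
    (omega0 : {skew_symmetric V}) (u v : g) : R :=
  omega u.1 v.1 + omega0 u.2 v.2.

Section Forms.
Variables (omega : {skew_symmetric h}) (omega0 : {skew_symmetric V}).

Fact semidirect_form_bilinear :
  bilinear_for *%R (idfun \; *%R) (semidirect_form omega omega0).
Proof.
split=> [w a u v|w a u v]; rewrite /semidirect_form /=.
- by rewrite !linearPl mulrDr addrACA.
- by rewrite !linearPr mulrDr addrACA.
Qed.

HB.instance Definition _ := bilinear_isBilinear.Build R g g R
  *%R (idfun \; *%R) (semidirect_form omega omega0) semidirect_form_bilinear.

Fact semidirect_form_skew u v : semidirect_form omega omega0 u v =
  (-1) ^+ true * idfun (semidirect_form omega omega0 v u).
Proof.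
by rewrite /semidirect_form mulrDr /= -(hermC omega) -(hermC omega0).
Qed.

HB.instance Definition _ := isHermitianSesquilinear.Build R g true idfun
  (semidirect_form omega omega0) semidirect_form_skew.

End Forms.

Definition semidirect_covector (theta : {scalar h}) (u : g) : R := theta u.1.

Fact semidirect_covector_linear theta : scalar (semidirect_covector theta).
Proof. by move=> a u v; rewrite /semidirect_covector /= linearP. Qed.

HB.instance Definition _ theta := GRing.isLinear.Build R g R *%R
  (semidirect_covector theta) (semidirect_covector_linear theta).

End SemidirectProduct.

(* An element of the second exterior power of the dual is a skew-symmetric
   bilinear form, which over a real field is the same as an alternating one. *)
Section LCS.
Variables (R : fieldType) (g : lieAlgType R).
Variables (omega : {skew_symmetric g}) (theta : {scalar g}).

Definition exterior_d (X Y Z : g) : R :=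
  - omega [lie X, Y] Z - omega [lie Y, Z] X - omega [lie Z, X] Y.

Definition wedge12 (X Y Z : g) : R :=
  theta X * omega Y Z + theta Y * omega Z X + theta Z * omega X Y.

Definition is_LCS : Prop :=
  [/\ nondegenerate omega,
      forall X Y, theta [lie X, Y] = 0
    & forall X Y Z, exterior_d X Y Z = wedge12 X Y Z].

(* Membership in the subalgebra g_omega. *)
Definition in_stabilizer (X : g) : Prop :=
  forall Y Z, omega [lie X, Y] Z + omega Y [lie X, Z] = 0.

Definition is_LCS_second_kind : Prop :=
  is_LCS /\ forall X, in_stabilizer X -> theta X = 0.

End LCS.

Definition in_sp (R : fieldType) (V : vectType R) (omega0 : {skew_symmetric V})
    (A : 'End(V)) : Prop :=
  forall Y Z, omega0 (A Y) Z = - omega0 Y (A Z).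

Section LCSRepresentations.
Variables (R : fieldType) (h : lieAlgType R) (V : vectType R).
Variables (theta : {scalar h}) (omega0 : {skew_symmetric V}).
Variable pi : representation h V.

Definition LCS_decomposition (rho : h -> 'End(V)) : Prop :=
  forall X, pi X = - (2^-1 * theta X) *: \1%VF + rho X /\ in_sp omega0 (rho X).

Definition is_LCS_representation : Prop := exists rho, LCS_decomposition rho.

End LCSRepresentations.

(* Main.v *)
Require Import Defs.
From mathcomp Require Import all_boot all_order all_algebra reals.
From mathcomp Require Import ring.

Set Implicit Arguments.
Unset Strict Implicit.
Unset Printing Implicit Defensive.

Import GRing.Theory.
Local Open Scope ring_scope.

(** The infinitesimal action of an endomorphism [A] of [V] on the form
    [omega0] is [(v, w) |-> omega0 (A v) w + omega0 v (A w)].  The theorem rests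
    on two facts about it.

    First, by [semidirect_exterior_d], the differential of the extended form
    is the differential of [omega] on the [h]-components, minus the cyclic sum
    of the actions of [pi X], [pi Y], [pi Z] on [omega0].  The wedge product of
    the extended covector and form splits in the same way, with
    [theta X * omega0 v w] in place of the action.  Since [omega] already
    satisfies the LCS equation on [h], the extended equation says that the
    two cyclic sums are opposite, and evaluating on one vector of [h] and two of [V]
    isolates a single term: each [pi X] must act on [omega0] as the scalar
    [- theta X] ([acts_conformally], [semidirect_is_LCSP]).

    Second, [c *: \1] acts on [omega0] as the scalar [2 * c].  Hence [pi X] acts
    as [- theta X] if and only if [pi X + (theta X / 2) *: \1] acts as zero, that
    is, lies in [sp V], which is the decomposition defining an LCS
    representation ([LCS_representationP]).

    The rest follows.  The map [rho] is [pi] plus the scalar operators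
    [(theta X / 2) *: \1].  Scalars are central and [theta] kills brackets, so
    [rho] is again a representation ([LCS_decomposition_representation]).  If
    [(X, v)] lies in the stabilizer of the extended form, then restricting to
    [V] shows that [pi X] acts as zero on [omega0]; but it acts as [- theta X],
    and [omega0], being non-degenerate on a nonzero space, is not the zero form,
    so [theta X = 0] ([conformal_stabilizer]). *)

Section SkewForms.
Variables (R : fieldType) (V : vectType R) (f : {skew_symmetric V}).

Lemma skew_formC u v : f u v = - f v u.
Proof. by rewrite hermC expr1 mulN1r. Qed.

Lemma nondegenerateP :
  reflect (forall u, (forall v, f u v = 0) -> u = 0) (nondegenerate f).
Proof.
apply: (iffP idP) => [/eqP nd u fu0|nd].
  by apply/eqP; rewrite -memv0 -nd; apply/mem_orthovP => v _; apply: fu0.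
apply/eqP/vspaceP => u; rewrite memv0.
apply/mem_orthovP/eqP => [fu0|-> v _]; last exact: linear0l.
by apply: nd => v; apply: fu0; rewrite memvf.
Qed.

Lemma nondegenerate_scale_eq0 c : nondegenerate f -> (0 < \dim {:V})%N ->
  (forall u v, c * f u v = 0) -> c = 0.
Proof.
move=> /nondegenerateP nd dimV cf0; apply/eqP; apply: contraTT dimV => c0.
rewrite -leqNgt leqn0 dimv_eq0 -vpick0; apply/eqP/nd => v.
by apply/eqP; have /eqP := cf0 (vpick {:V}) v; rewrite mulf_eq0 (negPf c0).
Qed.

End SkewForms.

Section LCSSemidirect.
Variables (R : fieldType) (h : lieAlgType R) (V : vectType R).
Variables (omega : {skew_symmetric h}) (theta : {scalar h}).
Variables (omega0 : {skew_symmetric V}) (pi : representation h V).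
Local Notation g := (semidirect pi).
Local Notation omega_t := (semidirect_form (pi := pi) omega omega0).
Local Notation theta_t := (semidirect_covector (pi := pi) theta).

Definition form_action (A : 'End(V)) (v w : V) : R :=
  omega0 (A v) w + omega0 v (A w).

Definition acts_conformally : Prop :=
  forall X v w, form_action (pi X) v w = - theta X * omega0 v w.

Lemma representation0 : pi 0 = 0.
Proof.
have [pl _] := repP pi.
by have := pl (-1) 0 0; rewrite scaler0 addr0 scaleN1r addNr.
Qed.

Lemma form_action0 v w : form_action 0 v w = 0.
Proof. by rewrite /form_action !zero_lfunE linear0l linear0r addr0. Qed.

Lemma in_spP A : in_sp omega0 A <-> forall v w, form_action A v w = 0.
Proof.
by split=> spA v w; apply/eqP; [rewrite addr_eq0|rewrite -addr_eq0];
  apply/eqP/spA.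
Qed.

(** Adding [c *: \1] changes the action on the form by the scalar [2 * c], which
    is where the factor one half of an LCS representation comes from. *)
Lemma form_action_shift c A v w :
  form_action (c *: \1%VF + A) v w = 2 * c * omega0 v w + form_action A v w.
Proof.
rewrite /form_action !add_lfunE !scale_lfunE !id_lfunE.
by rewrite !linearPl !linearPr /=; ring.
Qed.

Lemma LCS_representationP : (2 : R) != 0 ->
  is_LCS_representation theta omega0 pi <-> acts_conformally.
Proof.
move=> n2; split=> [[rho dec] X v w|conf].
  have [-> /in_spP sp] := dec X.
  by rewrite form_action_shift sp addr0 mulrN mulVKf.
exists (fun X => (2^-1 * theta X) *: \1%VF + pi X) => X; split.
  by rewrite addrA -scalerDl addNr scale0r add0r.
by apply/in_spP => v w; rewrite form_action_shift conf mulVKf // mulNr subrr.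
Qed.

Lemma LCS_decomposition_representation rho :
  (forall X Y, theta [lie X, Y] = 0) ->
  LCS_decomposition theta omega0 pi rho -> is_representation rho.
Proof.
have [pl pb] := repP pi => closed dec.
have rhoE X : rho X = (2^-1 * theta X) *: \1%VF + pi X.
  by have [-> _] := dec X; rewrite addrA -scalerDl subrr scale0r add0r.
split=> [a X Y|X Y]; rewrite !rhoE.
  rewrite pl linearP /= scalerDr scalerA addrACA -scalerDl.
  by congr (_ *: _ + _); ring.
rewrite closed mulr0 scale0r add0r pb.
(* Scalar operators commute with everything, so they drop out of the bracket. *)
apply/lfunP => z.
rewrite !(add_lfunE, opp_lfunE, comp_lfunE, scale_lfunE, id_lfunE).
rewrite !(linearD (pi _)) !(linearZ_LR (pi _)) /=.
rewrite !scalerDr !scalerA (mulrC (_ * theta Y)).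
rewrite (addrACA _ (_ *: pi Y z)) opprD [RHS]addrACA subrr add0r.
by rewrite opprD addrACA subrr add0r.
Qed.

Lemma semidirect_nondegenerate :
  nondegenerate omega -> nondegenerate omega0 -> nondegenerate omega_t.
Proof.
move=> /nondegenerateP nd /nondegenerateP nd0.
apply/nondegenerateP => -[x v] ort; congr pair.
  by apply: nd => y; have := ort (y, 0);
    rewrite /= /semidirect_form /= linear0r addr0.
by apply: nd0 => w; have := ort (0, w);
  rewrite /= /semidirect_form /= linear0r add0r.
Qed.

(** The [V]-component of a bracket is a difference of two terms, one for each
    entry acting on the other.  Each operator therefore occurs in two of the
    three brackets, and by skew-symmetry its two terms form one action on
    [omega0]. *)
Lemma semidirect_exterior_d (X Y Z : g) :
  exterior_d omega_t X Y Z = exterior_d omega X.1 Y.1 Z.1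
    - (form_action (pi X.1) Y.2 Z.2 + form_action (pi Y.1) Z.2 X.2
       + form_action (pi Z.1) X.2 Y.2).
Proof.
rewrite /exterior_d /= /semidirect_form /form_action /=.
rewrite !linearBl /= (skew_formC _ _ (pi X.1 _)) (skew_formC _ _ (pi Y.1 _)).
rewrite (skew_formC _ _ (pi Z.1 _)).
ring.
Qed.

Lemma semidirect_wedge12 (X Y Z : g) :
  wedge12 omega_t theta_t X Y Z = wedge12 omega theta X.1 Y.1 Z.1
    + (theta X.1 * omega0 Y.2 Z.2 + theta Y.1 * omega0 Z.2 X.2
       + theta Z.1 * omega0 X.2 Y.2).
Proof.
by rewrite /wedge12 /= /semidirect_covector /semidirect_form; ring.
Qed.

Lemma semidirect_is_LCSP : is_LCS omega theta -> nondegenerate omega0 ->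
  is_LCS omega_t theta_t <-> acts_conformally.
Proof.
move=> [nd closed lcs] nd0; split=> [[_ _ lcs_t] X v w|conf].
  (* On a triple with one entry in h and two in V, the other two terms of each
     cyclic sum contain [pi 0] or [theta 0]. *)
  have := lcs_t (X, 0) (0, v) (0, w).
  rewrite semidirect_exterior_d semidirect_wedge12 lcs => /addrI /=.
  rewrite representation0 !form_action0 linear0 !mul0r !addr0 => /= lcs_XVV.
  by rewrite mulNr -lcs_XVV opprK.
split; first exact: semidirect_nondegenerate.
  by move=> X Y; apply: closed.
move=> X Y Z; rewrite semidirect_exterior_d semidirect_wedge12 lcs.
by rewrite !conf; ring.
Qed.

(** Bracketing with [X] preserves [V] and acts there by [pi X.1], so an element
    of the stabilizer must act on [omega0] by zero; a conformal action leaves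
    this to [theta] alone. *)
Lemma conformal_stabilizer : acts_conformally ->
  nondegenerate omega0 -> (0 < \dim {:V})%N ->
  forall X, in_stabilizer omega_t X -> theta_t X = 0.
Proof.
move=> conf nd0 dimV X stab.
apply: (nondegenerate_scale_eq0 nd0 dimV) => v w; apply: oppr_inj.
rewrite oppr0 -(stab (0, v) (0, w)) -mulNr -conf.
rewrite /= /semidirect_form /= /semidirect_lie /=.
by rewrite representation0 zero_lfunE !subr0 linear0r linear0l !add0r.
Qed.

End LCSSemidirect.

Theorem theorem3p3 (R : realType) (h : lieAlgType R)
    (omega : {skew_symmetric h}) (theta : {scalar h}) (n : nat)
    (V : vectType R) (omega0 : {skew_symmetric V}) (pi : representation h V) :
  is_LCS omega theta ->
  nondegenerate omega0 -> (1 <= n)%N -> \dim {:V} = (2 * n)%N ->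
  let omega_t := semidirect_form (pi := pi) omega omega0 in
  let theta_t := semidirect_covector (pi := pi) theta in
  (is_LCS omega_t theta_t <-> is_LCS_representation theta omega0 pi) /\
  (is_LCS_representation theta omega0 pi ->
     (forall rho : h -> 'End(V), LCS_decomposition theta omega0 pi rho ->
        is_representation rho /\ forall X, in_sp omega0 (rho X)) /\
     is_LCS_second_kind omega_t theta_t).
Proof.
move=> lcs nd0 n_gt0 dimV omega_t theta_t.
have two_neq0 : (2 : R) != 0 by rewrite Num.Theory.pnatr_eq0.
have dimV_gt0 : (0 < \dim {:V})%N by rewrite dimV muln_gt0.
have lcs_tP := semidirect_is_LCSP pi lcs nd0.
have lcs_repP := LCS_representationP theta omega0 pi two_neq0.
split; first exact: iff_trans lcs_tP (iff_sym lcs_repP).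
move=> /lcs_repP conf; split=> [rho dec|].
  split=> [|X]; last by have [] := dec X.
  by case: lcs => _ closed _; apply: LCS_decomposition_representation dec.
split; first exact/lcs_tP.
exact: conformal_stabilizer.
Qed.
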